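(* Let $C\ge2$ be an integer, $\beta>0$, and $\Delta^{C-1}=\{\bm r\in[0,1]^C:\sum_{c=1}^C r_c=1\}$. For $\bm r\in\Delta^{C-1}$ and $y\in\{1,\ldots,C\}$ put $$\ell_\beta(\bm r,y)=\frac1\beta+\sum_{c=1}^C r_c^{1+\beta}-\frac{1+\beta}{\beta}\,r_y^{\beta}.$$ (i) For every $\bm r\in\Delta^{C-1}$ and $y\in\{1,\ldots,C\}$, $$0\le \ell_\beta(\bm r,y)\le\frac{1+\beta}{\beta}.$$ (ii) Let $\bm\pi\in\Delta^{C-1}$ have all $\pi_c>0$, let $\bm z\in\mathbb R^C$, $\bm u=\bm z+\log\bm\pi$, $\bm r=\operatorname{softmax}(\bm u)$, and $S_\beta(\bm r)=\sum_{j=1}^C r_j^{1+\beta}$. Then for every $y,k\in\{1,\ldots,C\}$, $$\frac{\partial \ell_\beta(\operatorname{softmax}(\bm u),y)}{\partial u_k}=(1+\beta)\Bigl[r_k\bigl(r_k^\beta-S_\beta(\bm r)+r_y^\beta\bigr)-\mathbb I[k=y]\,r_y^\beta\Bigr].$$ (iii) If $r_y\to0$ and $r_m\to1$ for one $m\ne y$, then for every $k\in\{1,\ldots,C\}$ the partial derivative in (ii) converges to $0$, whereas the cross-entropy target gradient $\partial(-\log r_y)/\partial u_y$ does not converge to $0$. (iv) Let $\bm s,\bm a\in\Delta^{C-1}$, $\varepsilon\in[0,1]$ and $\bm s_\varepsilon=(1-\varepsilon)\bm s+\varepsilon\bm a$. For every fixed $\bm r\in\Delta^{C-1}$, $$\Bigl|\mathbb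 E_{L\sim\bm s_\varepsilon}\ell_\beta(\bm r,L)-\mathbb E_{L\sim\bm s}\ell_\beta(\bm r,L)\Bigr|\le\varepsilon\,\frac{1+\beta}{\beta}.$$
   Context: Notation: $\operatorname{softmax}(\bm u)_c=e^{u_c}/\sum_{k=1}^C e^{u_k}$ for $\bm u\in\mathbb R^C$; $\log\bm\pi=(\log\pi_1,\ldots,\log\pi_C)$ componentwise; $\mathbb I[\cdot]$ is the indicator; for $\bm s\in\Delta^{C-1}$, $L\sim\bm s$ means $\Pr(L=c)=s_c$, so $\mathbb E_{L\sim\bm s}\ell_\beta(\bm r,L)=\sum_c s_c\,\ell_\beta(\bm r,c)$. The cross-entropy loss at label $y$ is $-\log r_y$ with $\bm r=\operatorname{softmax}(\bm u)$. *)

(* Defs.v *)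
From mathcomp Require Import all_boot all_order all_algebra.
From mathcomp Require Import all_classical all_reals all_analysis.

Set Implicit Arguments.
Unset Strict Implicit.
Unset Printing Implicit Defensive.

Import Order.TTheory GRing.Theory Num.Theory.
Import numFieldNormedType.Exports.

Local Open Scope ring_scope.
Local Open Scope classical_set_scope.

Definition simplex (R : realType) (C : nat) : set 'rV[R]_C :=
  [set r | (forall c, 0 <= r 0 c <= 1) /\ \sum_c r 0 c = 1].
Arguments simplex : clear implicits.

Definition softmax (R : realType) (C : nat) (u : 'rV[R]_C) : 'rV[R]_C :=
  \row_c (expR (u 0 c) / \sum_k expR (u 0 k)).

Definition logv (R : realType) (C : nat) (p : 'rV[R]_C) : 'rV[R]_C :=
  map_mx (@ln R) p.

Definition powsum (R : realType) (C : nat) (beta : R) (r : 'rV[R]_C) : R :=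
  \sum_j r 0 j `^ (1 + beta).

Definition ell (R : realType) (C : nat) (beta : R) (r : 'rV[R]_C)
    (y : 'I_C) : R :=
  1 / beta + \sum_c r 0 c `^ (1 + beta) - (1 + beta) / beta * r 0 y `^ beta.

Definition cross_entropy (R : realType) (C : nat) (r : 'rV[R]_C)
    (y : 'I_C) : R :=
  - ln (r 0 y).

(* Expectation of [f L] for a label [L] with [Pr(L = c) = s 0 c]. *)
Definition label_expect (R : realType) (C : nat) (s : 'rV[R]_C)
    (f : 'I_C -> R) : R :=
  \sum_c s 0 c * f c.

(* The partial derivative with respect to coordinate [k] is the directional
   derivative along the basis row vector [delta_mx 0 k].  As ['D_v f a] is
   total, existence has to be asserted separately by [derivable]. *)
Definition has_partial (R : realType) (C : nat) (f : 'rV[R]_C -> R)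
    (k : 'I_C) (u : 'rV[R]_C) : Prop :=
  derivable (f : 'rV[R]_C -> R^o) u (delta_mx 0 k).

Definition partial (R : realType) (C : nat) (f : 'rV[R]_C -> R)
    (k : 'I_C) (u : 'rV[R]_C) : R :=
  'D_(delta_mx 0 k) (f : 'rV[R]_C -> R^o) u.

(* Main.v *)
(** The lower bound in (i) is Young's inequality applied to [r_y^beta * 1], and
    the upper bound holds because [r_c^(1+beta) <= r_c].  Part (ii) is the chain
    rule from [d r_c / d u_k = r_c (I[k = c] - r_k)].  For (iii), [r_m -> 1]
    drives [r] to the vertex [m] of the simplex, where the continuous expression
    of (ii) vanishes, while the cross-entropy gradient is [r_y - 1 -> -1].  For
    (iv), the expectation is affine in the label law, so the difference is [eps]
    times a difference of two expectations that both lie in the interval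
    of (i). *)
Require Import Defs.
From mathcomp Require Import all_boot all_order all_algebra.
From mathcomp Require Import all_classical all_reals all_analysis.
From mathcomp Require Import ring lra.
Set Implicit Arguments.
Unset Strict Implicit.

Import Order.TTheory GRing.Theory Num.Theory.
Import numFieldNormedType.Exports.
Local Open Scope ring_scope.
Local Open Scope classical_set_scope.

Section DirectionalDerivative.
Variables (R : realType) (V : normedModType R).
Implicit Types (x v : V) (f : V -> R^o).

(** Restriction to the line through [x] along [v] turns directional derivatives into one-variable
    ones, where the usual calculus rules apply. *)
Lemma is_derive_line f x v (df : R) :
  is_derive x v f df <-> is_derive (0 : R) 1 (fun h : R => f (h *: v + x)) df.
Proof.
suff E : 'D_1 (fun h : R => f (h *: v + x)) 0 = 'D_v f x.
  by split=> -[fx <-]; apply: DeriveDef => //; apply/(derivable1P f x v).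
rewrite /derive; set g := fun h => _; set g' := fun h => _.
suff -> : g = g' by [].
by apply/funext => h; rewrite /g /g' /= addr0 scale0r add0r [_%:A]mulr1.
Qed.

Lemma is_derive_comp_scalar (g : R -> R) f x v (dg df : R) :
  is_derive (f x) 1 g dg -> is_derive x v f df ->
  is_derive x v (g \o f : V -> R^o) (dg * df).
Proof.
move=> gfx /is_derive_line fxv; apply/is_derive_line.
by apply: is_derive1_comp; rewrite scale0r add0r.
Qed.

End DirectionalDerivative.

Lemma is_derive_partial (R : realType) (C : nat) (f : 'rV[R]_C -> R)
    (k : 'I_C) (u : 'rV[R]_C) (df : R) :
  is_derive u (delta_mx 0 k) (f : 'rV[R]_C -> R^o) df ->
  has_partial f k u /\ partial f k u = df.
Proof. by case. Qed.

Lemma is_derive_coord (R : realType) (C : nat) (c : 'I_C) (u v : 'rV[R]_C) :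
  is_derive u v (fun w => w 0 c : R^o) (v 0 c).
Proof.
apply/is_derive_line.
rewrite (_ : (fun _ => _) = (v 0 c \*o id) + cst (u 0 c)); last first.
  by apply/funext => h /=; rewrite !mxE mulrC.
apply: is_derive_eq; rewrite addr0; exact: mulr1.
Qed.

Section Softmax.
Variables (R : realType) (C : nat).
Implicit Types (u : 'rV[R]_C) (y k c : 'I_C).

(** The index [c] witnesses that the sum is nonempty. *)
Lemma sum_expR_gt0 u c : 0 < \sum_k expR (u 0 k).
Proof.
by rewrite (bigD1 c) //= ltr_pwDl ?expR_gt0 // sumr_ge0.
Qed.

Lemma softmax_gt0 u c : 0 < softmax u 0 c.
Proof. by rewrite mxE divr_gt0 ?expR_gt0 ?(sum_expR_gt0 u c). Qed.

Lemma softmax_sum1 u c : \sum_k softmax u 0 k = 1.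
Proof.
rewrite -[RHS](divff (lt0r_neq0 (sum_expR_gt0 u c))) mulr_suml.
by apply: eq_bigr => k _; rewrite mxE.
Qed.

Lemma is_derive_softmax u k c :
  is_derive u (delta_mx 0 k) (fun v => softmax v 0 c : R^o)
    (softmax u 0 c * ((k == c)%:R - softmax u 0 k)).
Proof.
have dexp j : is_derive u (delta_mx 0 k) (fun v => expR (v 0 j) : R^o)
    (expR (u 0 j) * (k == j)%:R).
  have := is_derive_coord j u (delta_mx 0 k); rewrite mxE eqxx /= eq_sym => duj.
  exact: is_derive_comp_scalar.
have dsum : is_derive u (delta_mx 0 k)
    (fun v => \sum_j expR (v 0 j) : R^o) (expR (u 0 k)).
  rewrite (_ : (fun v => _) = \sum_j (fun v : 'rV[R]_C => expR (v 0 j) : R^o)).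
    apply: is_derive_eq.
    rewrite (bigD1 k) //= eqxx mulr1 big1 ?addr0 // => j.
    by rewrite eq_sym => /negPf ->; rewrite mulr0.
  by apply/funext => v; rewrite fct_sumE.
have S0 : \sum_j expR (u 0 j) != 0 by rewrite gt_eqF // (sum_expR_gt0 u c).
have dinv := is_deriveV S0 (is_derive_id (\sum_j expR (u 0 j)) (1 : R)).
have dV := is_derive_comp_scalar dinv dsum.
(* The quotient is recast as a product with the inverse of the normalising sum, so that the product
   rule combines [dexp] and [dV]. *)
rewrite (_ : (fun v => _) = (fun v : 'rV[R]_C => expR (v 0 c) : R^o) *
   (GRing.inv \o (fun v : 'rV[R]_C => \sum_j expR (v 0 j) : R^o))).
  apply: is_derive_eq; rewrite !mxE /= /GRing.scale /=.
  by field.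
by apply/funext => v; rewrite mxE.
Qed.

Lemma is_derive_softmax_powR u k c (a : R) :
  is_derive u (delta_mx 0 k) (fun v => softmax v 0 c `^ a : R^o)
    (a * softmax u 0 c `^ a * ((k == c)%:R - softmax u 0 k)).
Proof.
have rc0 := softmax_gt0 u c.
have := is_derive_comp_scalar (is_derive1_powR a rc0)
  (is_derive_softmax u k c).
(* Since [r_c > 0], [r_c^(a-1)] is [r_c^a / r_c]; the division cancels the factor [r_c] of the
   softmax derivative. *)
rewrite powRB ?powRr1 ?ltW //; last by rewrite (gt_eqF rc0) implybT.
move=> /is_derive_eq; apply; field; exact: lt0r_neq0.
Qed.

Lemma is_derive_ell_softmax (beta : R) u y k : 0 < beta ->
  let r := softmax u in
  is_derive u (delta_mx 0 k) (fun v => ell beta (softmax v) y : R^o)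
    ((1 + beta) *
       (r 0 k * (r 0 k `^ beta - powsum beta r + r 0 y `^ beta)
        - (k == y)%:R * r 0 y `^ beta)).
Proof.
move=> b0 r.
have dpow := is_derive_softmax_powR u k.
rewrite (_ : (fun v => _) = cst (1 / beta)
  + \sum_c (fun v : 'rV[R]_C => softmax v 0 c `^ (1 + beta) : R^o)
  - (1 + beta) / beta \*: (fun v => softmax v 0 y `^ beta : R^o)); last first.
  by apply/funext => v; rewrite /ell /= !fctE fct_sumE.
apply: is_derive_eq; rewrite /GRing.scale /= -/r add0r.
(* The factor [I[k = c] - r_k] splits the sum in two: the indicator keeps only the term [c = k], and
   the rest is a multiple of [r_k * powsum beta r]. *)
under eq_bigr do rewrite mulrBr.
rewrite sumrB -mulr_suml -mulr_sumr -/(powsum beta r).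
rewrite (bigD1 k) //= eqxx mulr1 big1; last first.
  by move=> j; rewrite eq_sym => /negPf ->; rewrite mulr0.
rewrite powRD; last by rewrite (gt_eqF (softmax_gt0 u k)) implybT.
rewrite powRr1 ?ltW ?softmax_gt0 //; field.
exact: lt0r_neq0.
Qed.

Lemma is_derive_cross_entropy_softmax u y k :
  is_derive u (delta_mx 0 k) (fun v => cross_entropy (softmax v) y : R^o)
    (softmax u 0 k - (k == y)%:R).
Proof.
have ry0 := softmax_gt0 u y.
have dln := is_derive_comp_scalar (is_derive1_ln ry0)
  (is_derive_softmax u k y).
have /is_derive_eq := is_deriveN dln; apply.
rewrite mulrA mulVf ?lt0r_neq0 // mul1r; ring.
Qed.

End Softmax.

Lemma ell_bounds (R : realType) (C : nat) (beta : R) (r : 'rV[R]_C) (y : 'I_C) :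
  0 < beta -> simplex R C r -> 0 <= ell beta r y <= (1 + beta) / beta.
Proof.
move=> b0 [r01 r1]; have b1 : 0 < 1 + beta by lra.
have rge0 c : 0 <= r 0 c by case/andP: (r01 c).
have bb0 : 0 <= (1 + beta) / beta by rewrite divr_ge0 ?ltW.
apply/andP; split.
  (* Young's inequality for [r_y^beta * 1] with exponents [(1+beta)/beta] and
     [1+beta]. *)
  have := @conjugate_powR R (r 0 y `^ beta) 1 ((1 + beta) / beta) (1 + beta)
    (powR_ge0 _ _) ler01.
  rewrite divr_gt0 // b1 => /(_ isT isT).
  have -> : ((1 + beta) / beta)^-1 + (1 + beta)^-1 = 1.
    by field; rewrite !lt0r_neq0.
  rewrite powR1 mulr1 -powRrM (_ : beta * _ = 1 + beta); last first.
    by field; rewrite lt0r_neq0.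
  (* Scaled by [(1+beta)/beta], Young's inequality reads [(1+beta)/beta * r_y^beta <= r_y^(1+beta) +
     1/beta]. *)
  move=> /(_ erefl) /(ler_wpM2l bb0).
  rewrite (_ : _ * (_ / _ + _ / _) = r 0 y `^ (1 + beta) + 1 / beta); last first.
    by field; rewrite !lt0r_neq0.
  have : r 0 y `^ (1 + beta) <= \sum_c r 0 c `^ (1 + beta).
    by rewrite (bigD1 y) //= lerDl sumr_ge0 // => c _; exact: powR_ge0.
  rewrite /ell; lra.
have : \sum_c r 0 c `^ (1 + beta) <= 1.
  rewrite -[leRHS]r1; apply: ler_sum => c _.
  have := rge0 c; rewrite le_eqVlt => /predU1P[<-|rc0].
    by rewrite powR0 ?lt0r_neq0.
  by apply: ge1r_powR; [rewrite rc0; case/andP: (r01 c) | lra].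
rewrite /ell.
have : 0 <= (1 + beta) / beta * r 0 y `^ beta by rewrite mulr_ge0 ?powR_ge0.
have -> : (1 + beta) / beta = 1 / beta + 1 by field; rewrite lt0r_neq0.
lra.
Qed.

(** For [l > 0] the power is differentiable, hence continuous, at [l]. The boundary value [l = 0],
    which occurs at a vertex of the simplex, is handled directly: [f t < e^(1/a)] gives
    [f t ^ a < e]. *)
Lemma cvg_powR (R : realType) (T : Type) (F : set_system T) (FF : Filter F)
    (f : T -> R) (l a : R) :
  0 < a -> (forall t, 0 <= f t) -> 0 <= l ->
  f t @[t --> F] --> l -> f t `^ a @[t --> F] --> l `^ a.
Proof.
move=> a0 f0; rewrite le_eqVlt => /predU1P[<-|l0] fl; last first.
  apply: (@cvg_comp _ _ _ f (fun x : R => x `^ a) _ _ _ fl).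
  by have [/derivable1_diffP/differentiable_continuous] := is_derive1_powR a l0.
rewrite powR0 ?lt0r_neq0 //; apply/cvgr0Pnorm_lt => e e0.
have ea0 : 0 < e `^ a^-1 by rewrite powR_gt0.
move/cvgr0Pnorm_lt : fl => /(_ _ ea0); apply: filterS => t.
rewrite !ger0_norm ?powR_ge0 // => ft.
have -> : e = (e `^ a^-1) `^ a by rewrite -powRrM mulVf ?lt0r_neq0 // powRr1 ?ltW.
by rewrite gt0_ltr_powR // nnegrE ?powR_ge0.
Qed.

(** As the coordinates are positive and sum to 1, each one other than [m] is squeezed between 0 and
    [1 - r_m]. *)
Lemma softmax_cvg_vertex (R : realType) (C : nat) (T : Type) (F : set_system T)
    (FF : Filter F) (u : T -> 'rV[R]_C) (m : 'I_C) :
  softmax (u t) 0 m @[t --> F] --> (1 : R) ->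
  forall k, softmax (u t) 0 k @[t --> F] --> ((k == m)%:R : R).
Proof.
move=> um k; case: eqVneq => [->//|km].
apply: (@squeeze_cvgr _ _ _ _ (cst 0) (fun t => 1 - softmax (u t) 0 m)).
- near=> t; rewrite /= ltW ?softmax_gt0 //=.
  rewrite lerBrDl -[leRHS](softmax_sum1 (u t) m) (bigD1 m) //= lerD2l.
  rewrite (bigD1 k) //= lerDl sumr_ge0 // => j _.
  exact/ltW/softmax_gt0.
- exact: cvg_cst.
- by rewrite -[X in _ --> X](subrr 1); apply: cvgB => //; exact: cvg_cst.
Unshelve. all: by end_near. Qed.

Lemma label_expect_bounds (R : realType) (C : nat) (s : 'rV[R]_C)
    (f : 'I_C -> R) (B : R) :
  simplex R C s -> (forall c, 0 <= f c <= B) -> 0 <= label_expect s f <= B.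
Proof.
move=> [s01 s1] fB; have s0 c : 0 <= s 0 c by case/andP: (s01 c).
rewrite sumr_ge0 => [|c _]; last by rewrite mulr_ge0 //; case/andP: (fB c).
rewrite -[leRHS]mul1r -s1 mulr_suml; apply: ler_sum => c _.
by rewrite ler_wpM2l //; case/andP: (fB c).
Qed.

Unset Implicit Arguments.
(** The limits in (iii) run along an arbitrary proper filter, with [p] fixed and [z] varying.
    Existence of the cross-entropy partial derivative is asserted there too, so that its failure to
    vanish is not an artefact of [partial] being total. *)
Theorem proposition2 (R : realType) (C : nat) (beta : R)
    (hC : (2 <= C)%N) (hbeta : 0 < beta) :
  (* (i) *)
  (forall (r : 'rV[R]_C) (y : 'I_C), simplex R C r ->
     0 <= ell beta r y <= (1 + beta) / beta)
  /\
  (* (ii) *)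
  (forall p z : 'rV[R]_C, simplex R C p -> (forall c, 0 < p 0 c) ->
     let u := z + logv p in
     let r := softmax u in
     forall y k : 'I_C,
       has_partial (fun v => ell beta (softmax v) y) k u /\
       partial (fun v => ell beta (softmax v) y) k u =
         (1 + beta) *
           (r 0 k * (r 0 k `^ beta - powsum beta r + r 0 y `^ beta)
            - (k == y)%:R * r 0 y `^ beta))
  /\
  (* (iii) *)
  (forall p : 'rV[R]_C, simplex R C p -> (forall c, 0 < p 0 c) ->
     forall (T : Type) (F : set_system T) (FF : ProperFilter F)
            (z : T -> 'rV[R]_C) (y m : 'I_C),
       let u := fun t => z t + logv p in
       m != y ->
       softmax (u t) 0 y @[t --> F] --> (0 : R) ->
       softmax (u t) 0 m @[t --> F] --> (1 : R) ->
       (forall k : 'I_C,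
          partial (fun v => ell beta (softmax v) y) k (u t) @[t --> F]
            --> (0 : R)) /\
       (forall t, has_partial (fun v => cross_entropy (softmax v) y) y (u t)) /\
       ~ (partial (fun v => cross_entropy (softmax v) y) y (u t) @[t --> F]
            --> (0 : R)))
  /\
  (* (iv) *)
  (forall (s a : 'rV[R]_C) (eps : R), simplex R C s -> simplex R C a ->
     0 <= eps <= 1 ->
     let s_eps := (1 - eps) *: s + eps *: a in
     forall r : 'rV[R]_C, simplex R C r ->
       `|label_expect s_eps (ell beta r) - label_expect s (ell beta r)|
         <= eps * ((1 + beta) / beta)).
Proof.
split; [|split; [|split]].
- by move=> r y; exact: ell_bounds.
- move=> p z _ _ u r y k.
  exact/is_derive_partial/is_derive_ell_softmax.
- move=> p _ _ T F FF z y m u my ry rm.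
  have rk := softmax_cvg_vertex _ rm.
  split=> [k|].
    under eq_fun do
      rewrite (is_derive_partial (is_derive_ell_softmax _ _ _ hbeta)).2.
    have powk (a : R) : 0 < a -> forall c,
        softmax (u t) 0 c `^ a @[t --> F] --> ((c == m)%:R : R).
      move=> a0 c.
      (* The coordinates 0 and 1 of the vertex are fixed by every positive power. *)
      have -> : (c == m)%:R = (c == m)%:R `^ a :> R.
        by case: eqP => _; rewrite ?powR1 ?powR0 ?lt0r_neq0.
      apply: cvg_powR => //; [|exact: rk].
      by move=> t; rewrite ltW // softmax_gt0.
    have Scvg : powsum beta (softmax (u t)) @[t --> F] --> (1 : R).
      have -> : 1 = \sum_c (c == m)%:R :> R.
        by rewrite (bigD1 m) //= eqxx big1 ?addr0 // => c /negPf ->.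
      by apply: cvg_big => [|c _]; [exact: add_continuous|apply: powk; lra].
    (* The right side is the formula of (ii) at the vertex [m]. Both terms in [y] vanish since [y]
       differs from [m], and [I[k = m] * (I[k = m] - 1)] is 0. *)
    have limE : (0 : R) = (1 + beta) * ((k == m)%:R * ((k == m)%:R - 1 + (y == m)%:R)
        - (k == y)%:R * (y == m)%:R).
      rewrite [y == m]eq_sym (negPf my).
      by case: (k == m); rewrite !mulr0 subr0 addr0 ?subrr ?mul0r !mulr0.
    rewrite limE.
    apply: cvgM; first exact: cvg_cst.
    apply: cvgB; last by apply: cvgM; [exact: cvg_cst|exact: powk].
    apply: cvgM; first exact: rk.
    apply: cvgD; last exact: powk.
    by apply: cvgB => //; exact: powk.
  split=> [t|].
    exact: (is_derive_partial (is_derive_cross_entropy_softmax _ _ _)).1.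
  under eq_fun do
    rewrite (is_derive_partial (is_derive_cross_entropy_softmax _ _ _)).2 eqxx.
  move=> ce0.
  have ceN1 : softmax (u t) 0 y - 1 @[t --> F] --> (0 - 1 : R).
    by apply: cvgB => //; exact: cvg_cst.
  (* Limits along a proper filter are unique, so 0 and -1 would coincide. *)
  have : 0 = 0 - 1 :> R by exact: (norm_cvg_unique ce0 ceN1).
  by move/eqP; rewrite sub0r eq_sym oppr_eq0 oner_eq0.
- move=> s a eps hs ha /andP[e0 _] s_eps r hr.
  have b c := ell_bounds c hbeta hr.
  have /andP[s0 sB] := label_expect_bounds hs b.
  have /andP[a0 aB] := label_expect_bounds ha b.
  have -> : label_expect s_eps (ell beta r) =
      (1 - eps) * label_expect s (ell beta r) + eps * label_expect a (ell beta r).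
    rewrite /label_expect !mulr_sumr -big_split /=.
    by apply: eq_bigr => c _; rewrite !mxE; ring.
  rewrite [X in `|X|](_ : _ =
    eps * (label_expect a (ell beta r) - label_expect s (ell beta r))); last by ring.
  (* Two numbers in [[0, (1+beta)/beta]] differ by at most the length of that interval. *)
  rewrite normrM ger0_norm // ler_wpM2l // ler_norml; lra.
Qed.
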